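(* Let $\alpha=(\alpha_n)_{n\in\mathbb{N}}$ be a sequence with $\alpha_n\uparrow\infty$. The following assertions are equivalent. (i) $\Lambda_0(\alpha)$ is nuclear. (ii) $\sigma(\mathsf{C};\Lambda_0(\alpha))=\sigma_{pt}(\mathsf{C};\Lambda_0(\alpha))$. (iii) $\sigma(\mathsf{C};\Lambda_0(\alpha))=\Sigma$.
   Context: Notation: $\mathbb{N}=\{1,2,3,\ldots\}$. The notation $\alpha_n\uparrow\infty$ means that $\alpha=(\alpha_n)_{n\in\mathbb{N}}\subseteq(1,\infty)$ satisfies $\alpha_n<\alpha_{n+1}$ for all $n\in\mathbb{N}$ and $\lim_{n\to\infty}\alpha_n=\infty$. For $k,n\in\mathbb{N}$ put $w_k(n):=e^{-\alpha_n/k}$. The power series space of finite type is $\Lambda_0(\alpha):=\{x\in\mathbb{C}^{\mathbb{N}}\colon \lim_{n\to\infty}w_k(n)|x_n|=0 \text{ for all } k\in\mathbb{N}\}$, a Fréchet space for the topology generated by the increasing sequence of norms $p_k(x):=\sup_{n\in\mathbb{N}}w_k(n)|x_n|$, $k\in\mathbb{N}$. The discrete Cesàro operator is $\mathsf{C}x:=\left(x_1,\frac{x_1+x_2}{2},\ldots,\frac{x_1+\cdots+x_n}{n},\ldots\right)$ for $x\in\mathbb{C}^{\mathbb{N}}$; it maps $\Lambda_0(\alpha)$ continuously into itself. For a locally convex Hausdorff space $X$, $\mathcal{L}(X)$ is the space of continuous linear operators from $X$ into itself; for $T\in\mathcal{L}(X)$ the resolvent set $\rho(T;X)$ consists of all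 $\lambda\in\mathbb{C}$ such that $(\lambda I-T)^{-1}$ exists in $\mathcal{L}(X)$, the spectrum is $\sigma(T;X):=\mathbb{C}\setminus\rho(T;X)$, and the point spectrum $\sigma_{pt}(T;X)$ is the set of $\lambda\in\mathbb{C}$ such that $\lambda I-T$ is not injective. Moreover, $\Sigma:=\{\frac1m\colon m\in\mathbb{N}\}$. *)

(* Defs.v *)
From HB Require Import structures.
From mathcomp Require Import all_boot all_order all_algebra.
From mathcomp Require Import all_classical all_reals all_analysis.
From mathcomp Require Import complex.

Set Implicit Arguments.
Unset Strict Implicit.
Unset Printing Implicit Defensive.

Import Order.TTheory GRing.Theory Num.Theory.
Import numFieldNormedType.Exports.
Import Normc.

Local Open Scope classical_set_scope.
Local Open Scope ring_scope.
Local Open Scope complex_scope.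
Local Open Scope convex_scope.

(* The complex numbers are R[i] for a realType R, and normc : R[i] -> R is the
   modulus. *)

Section Nuclear.
Variable R : realType.

Definition is_seminorm (V : lmodType R[i]) (p : V -> R) : Prop :=
  [/\ forall x, 0 <= p x,
      forall (a : R[i]) x, p (a *: x) = normc a * p x &
      forall x y, p (x + y) <= p x + p y].

Definition dual_norm (V : lmodType R[i]) (q : V -> R) (f : V -> R[i]) : \bar R :=
  ereal_sup [set (normc (f x))%:E | x in [set x | q x <= 1]].

(* (V, q) and (W, p) are seminormed spaces standing for the normed spaces V/ker q
   and W/ker p.  A bounded functional on V/ker q is a functional f on V with
   dual_norm q f < +oo, and convergence in W/ker p is convergence for p.  So this
   says that T induces a nuclear map x |-> \sum_n f_n(x) y_n from V/ker q to
   W/ker p. *)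
Definition nuclear_map (V W : lmodType R[i]) (q : V -> R) (p : W -> R)
    (T : V -> W) : Prop :=
  exists (f : nat -> {scalar V}) (y : nat -> W),
    [/\ forall n, (dual_norm q (f n) < +oo)%E,
        (\sum_(0 <= n <oo) (dual_norm q (f n) * (p (y n))%:E) < +oo)%E &
        forall x, p (T x - \sum_(0 <= n < N) f n x *: y n) @[N --> \oo] --> 0].

(* Pietsch's definition: every continuous seminorm p is dominated by a continuous
   seminorm q for which the canonical map E/ker q -> E/ker p is nuclear. *)
Definition nuclear_space (E : tvsType R[i]) : Prop :=
  forall p : E -> R, is_seminorm p -> continuous p ->
    exists q : E -> R,
      [/\ is_seminorm q, continuous q, forall x, p x <= q x &
          nuclear_map q p idfun].

End Nuclear.

Section Spectrum.
Variables (R : realType) (E : tvsType R[i]) (T : E -> E).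

Definition resolvent_set : set R[i] :=
  [set l | exists S : {linear E -> E},
     [/\ continuous S,
         cancel (fun x => l *: x - T x) S &
         cancel S (fun x => l *: x - T x)]].

Definition spectrum : set R[i] := ~` resolvent_set.

Definition point_spectrum : set R[i] :=
  [set l | ~ injective (fun x => l *: x - T x)].

End Spectrum.

(* All indices are shifted: index n : nat stands for n + 1 in {1, 2, ...}. *)

Definition diverging (R : realType) (alpha : nat -> R) : Prop :=
  [/\ forall n, 1 < alpha n,
      forall n, alpha n < alpha n.+1 &
      alpha n @[n --> \oo] --> +oo].

Definition weight (R : realType) (alpha : nat -> R) (k n : nat) : R :=
  expR (- alpha n / k.+1%:R).

Definition Lambda0_pred (R : realType) (alpha : nat -> R) :
    {pred nat -> R[i]} :=
  fun x => `[< forall k,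
    weight alpha k n * normc (x n) @[n --> \oo] --> (0 : R) >].

Record Lambda0 (R : realType) (alpha : nat -> R) := MkLambda0 {
  Lambda0_val :> nat -> R[i];
  Lambda0_valP : Lambda0_val \in Lambda0_pred alpha }.

Lemma normc_ge0 (R : realType) (a : R[i]) : 0 <= normc a.
Proof. by case: a => a b; exact: sqrtr_ge0. Qed.

Lemma normr_normc (R : realType) (a : R[i]) : `|a| = (normc a)%:C.
Proof. by []. Qed.

Section Lambda0_structure.
Variables (R : realType) (alpha : nat -> R).
Local Notation L := (Lambda0 alpha).

Lemma Lambda0_submod_closed : submod_closed (Lambda0_pred alpha).
Proof.
split.
  apply/asboolP => k.
  rewrite (_ : (fun _ => _) = cst 0); first exact: cvg_cst.
  by apply/funext => n; rewrite [normc _](@normc0 R) mulr0.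
move=> a x y /asboolP xP /asboolP yP; apply/asboolP => k.
have H : normc a * (weight alpha k n * normc (x n)) +
    weight alpha k n * normc (y n) @[n --> \oo] --> (0 : R).
  rewrite (_ : 0 = normc a * 0 + 0); last by rewrite mulr0 addr0.
  by apply: cvgD; [exact: cvgMr (xP k)|exact: yP].
apply: (squeeze_cvgr _ (cvg_cst 0) H).
apply: nearW => n; apply/andP; split.
  by rewrite mulr_ge0 ?expR_ge0 ?normc_ge0.
rewrite mulrCA -normcM -mulrDr ler_wpM2l ?expR_ge0//.
exact: le_normcD.
Qed.

HB.instance Definition _ :=
  GRing.isSubmodClosed.Build _ _ (Lambda0_pred alpha) Lambda0_submod_closed.
HB.instance Definition _ := [isSub for @Lambda0_val R alpha].
HB.instance Definition _ := [Choice of L by <:].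
HB.instance Definition _ := [SubChoice_isSubLmodule of L by <:].

Lemma Lambda0_eqP (x y : L) : x = y <-> (x : nat -> R[i]) =1 y.
Proof. by split=> [->//|xy]; apply/val_inj/funext. Qed.

Lemma Lambda0_cvg (x : L) k :
  weight alpha k n * normc (x n) @[n --> \oo] --> (0 : R).
Proof. by have /asboolP := Lambda0_valP x; exact. Qed.

Definition pnorm (k : nat) (x : L) : R :=
  sup (range (fun n => weight alpha k n * normc (x n))).

Lemma pnorm_has_sup k (x : L) :
  has_sup (range (fun n => weight alpha k n * normc (x n))).
Proof.
split; first by exists (weight alpha k 0 * normc (x 0%N)); exists 0%N.
have /cvg_seq_bounded := cvgP _ (@Lambda0_cvg x k).
move=> [M [_ /(_ (M + 1))]]; rewrite ltrDl ltr01 => /(_ isT) B.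
by exists (M + 1) => _ [n _ <-]; rewrite (le_trans (ler_norm _))//; exact: B.
Qed.

Lemma pnorm_ub k (x : L) n : weight alpha k n * normc (x n) <= pnorm k x.
Proof. by apply: sup_upper_bound; [exact: pnorm_has_sup|exists n]. Qed.

Lemma pnorm_le k (x : L) M :
  (forall n, weight alpha k n * normc (x n) <= M) -> pnorm k x <= M.
Proof.
move=> H; apply: ge_sup; first by have [] := pnorm_has_sup k x.
by move=> _ [n _ <-].
Qed.

Lemma pnorm_ge0 k x : 0 <= pnorm k x.
Proof.
by apply: le_trans (pnorm_ub k x 0); rewrite mulr_ge0 ?expR_ge0 ?normc_ge0.
Qed.

Lemma pnormD k x y : pnorm k (x + y) <= pnorm k x + pnorm k y.
Proof.
apply: pnorm_le => n; apply: le_trans (lerD (pnorm_ub k x n) (pnorm_ub k y n)).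
by rewrite -mulrDr ler_wpM2l ?expR_ge0//; exact: le_normcD.
Qed.

Lemma pnormZ k (a : R[i]) x : pnorm k (a *: x) = normc a * pnorm k x.
Proof.
have le1 (b : R[i]) z : pnorm k (b *: z) <= normc b * pnorm k z.
  apply: pnorm_le => n; rewrite normcM mulrCA ler_wpM2l ?normc_ge0//.
  exact: pnorm_ub.
apply/eqP; rewrite eq_le le1 /=.
have [->|a0] := eqVneq a 0; first by rewrite normc0 mul0r pnorm_ge0.
have na0 : 0 < normc a.
  rewrite lt_neqAle normc_ge0 andbT eq_sym.
  by apply: contra a0 => /eqP/eq0_normc ->.
rewrite -ler_pdivlMl// -normcV -[in leLHS](scale1r x) -(mulVf a0) -scalerA.
exact: le1.
Qed.

Lemma pnorm_seminorm k : is_seminorm (pnorm k).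
Proof. by split; [exact: pnorm_ge0|exact: pnormZ|exact: pnormD]. Qed.

Lemma pnorm0 k : pnorm k 0 = 0.
Proof. by rewrite -(scale0r 0) pnormZ normc0 mul0r. Qed.

Lemma pnormB k x y : pnorm k (x - y) = pnorm k (y - x).
Proof. by rewrite -opprB -scaleN1r pnormZ normcN normc1 mul1r. Qed.

Definition pball (k : nat) (e : R) (x : L) : set L :=
  [set y | forall j, (j <= k)%N -> pnorm j (y - x) < e].

(* The neighbourhoods of the topology generated by the family (pnorm k)_k.  pball
   intersects finitely many balls, so that this holds for every alpha; for positive
   alpha the norms increase with k, and the ball of pnorm k alone is the same set. *)
Definition Lambda0_nbhs (x : L) : set_system L :=
  [set A | exists k e, 0 < e /\ pball k e x `<=` A].

HB.instance Definition _ := hasNbhs.Build L Lambda0_nbhs.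

Lemma pball_center k e x : 0 < e -> pball k e x x.
Proof. by move=> e0 j _; rewrite subrr pnorm0. Qed.

Lemma nbhs_pball k e x : 0 < e -> nbhs x (pball k e x).
Proof. by move=> e0; exists k, e; split. Qed.

Lemma pball_sub k k' e e' x :
  (k <= k')%N -> e' <= e -> pball k' e' x `<=` pball k e x.
Proof.
by move=> kk ee y yP j jk; rewrite (lt_le_trans _ ee)// yP// (leq_trans jk).
Qed.

Let nbhs_filter_proof (x : L) : ProperFilter (nbhs x).
Proof.
apply: Build_ProperFilter.
  by move=> [k [e [e0 /(_ x)]]]; apply; exact: pball_center.
split.
- by exists 0%N, 1; split; [exact: ltr01|].
- move=> A B [k [e [e0 kA]]] [k' [e' [e'0 kB]]].
  exists (maxn k k'), (Num.min e e'); split; first by rewrite lt_min e0.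
  move=> y yP; split.
    by apply: kA; apply: pball_sub yP; rewrite ?leq_maxl ?ge_min ?lexx.
  by apply: kB; apply: pball_sub yP; rewrite ?leq_maxr ?ge_min ?lexx ?orbT.
- by move=> A B AB [k [e [e0 kA]]]; exists k, e; split=> // y /kA/AB.
Qed.

Let nbhs_singleton_proof (x : L) (A : set L) : nbhs x A -> A x.
Proof. by move=> [k [e [e0]]]; apply; exact: pball_center. Qed.

Let pball_room k e x y : pball k e x y ->
  exists2 d, 0 < d & pball k d y `<=` pball k e x.
Proof.
move=> yP; pose m := \big[Num.max/0]_(j < k.+1) pnorm j (y - x).
have e0 : 0 < e by apply: le_lt_trans (yP 0%N isT); exact: pnorm_ge0.
have me : m < e.
  by rewrite /m; apply: bigmax_lt => // j _; apply: yP; rewrite -ltnS.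
have mP j : (j <= k)%N -> pnorm j (y - x) <= m.
  rewrite -ltnS => jk.
  exact: (le_bigmax _ (fun j : 'I_k.+1 => pnorm j (y - x)) (Ordinal jk)).
exists (e - m); rewrite ?subr_gt0// => z zP j jk.
rewrite -(subrKA y) (le_lt_trans (pnormD _ _ _))//.
by rewrite -(subrK m e) ltr_leD ?zP ?mP.
Qed.

Let nbhs_nbhs_proof (x : L) (A : set L) : nbhs x A -> nbhs x (nbhs^~ A).
Proof.
move=> [k [e [e0 kA]]]; exists k, e; split=> // y /pball_room[d d0 dP].
by exists k, d; split=> // z /dP/kA.
Qed.

HB.instance Definition _ := Nbhs_isNbhsTopological.Build L
  nbhs_filter_proof nbhs_singleton_proof nbhs_nbhs_proof.

Lemma open_pball k e x : open (pball k e x).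
Proof.
by rewrite openE => y /pball_room[d d0 dP]; exists k, d; split.
Qed.

Let add_continuous_proof : continuous (fun x : L * L => x.1 + x.2).
Proof.
move=> [x y] A /= [k [e [e0 kA]]].
exists (pball k (e / 2) x, pball k (e / 2) y) => /=.
  by split; apply: nbhs_pball; rewrite divr_gt0.
move=> [x' y'] /= [xx yy]; apply: kA => j jk /=.
rewrite opprD addrACA (le_lt_trans (pnormD _ _ _))// [ltRHS]splitr.
by rewrite ltrD ?xx ?yy.
Qed.

Let scale_continuous_proof :
  continuous (fun z : (R[i])^o * L => z.1 *: z.2).
Proof.
move=> [a x] A /= [k [e [e0 kA]]].
pose M := 1 + \big[Num.max/0]_(j < k.+1) pnorm j x.
have M0 : 0 < M by rewrite ltr_pwDl// bigmax_ge_id.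
have MP j : (j <= k)%N -> pnorm j x <= M.
  rewrite -ltnS => jk; rewrite -[leLHS]add0r lerD//.
  exact: (le_bigmax _ (fun j : 'I_k.+1 => pnorm j x) (Ordinal jk)).
pose d := e / 2 / M.
have d0 : 0 < d by rewrite !divr_gt0.
pose c := e / 2 / (normc a + d).
have ad0 : 0 < normc a + d by rewrite ltr_wpDl ?normc_ge0.
have c0 : 0 < c by rewrite !divr_gt0.
exists ([set b : (R[i])^o | normc (b - a) < d], pball k c x) => /=.
  split; last exact: nbhs_pball.
  exists d%:C; first by rewrite /= ltcR.
  by move=> b /=; rewrite -normrN opprB normr_normc ltcR.
move=> [b y] /= [bd yc]; apply: kA => j jk /=.
have -> : b *: y - a *: x = b *: (y - x) + (b - a) *: x.
  by rewrite scalerBr scalerBl addrA subrK.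
rewrite (le_lt_trans (pnormD _ _ _))// [ltRHS]splitr !pnormZ.
rewrite ltr_leD//.
  have nb : normc b <= normc a + d.
    by rewrite -(subrKC a b) (le_trans (le_normcD _ _))// lerD2l ltW.
  rewrite (le_lt_trans (ler_wpM2r (pnorm_ge0 _ _) nb))//.
  by rewrite mulrC -ltr_pdivlMr// yc.
apply: (@le_trans _ _ (d * M)); last by rewrite /d divfK ?gt_eqF.
by rewrite ler_pM ?normc_ge0 ?pnorm_ge0 ?MP// ltW.
Qed.

Let locally_convex_proof : exists2 B : set_system L,
  (forall b, b \in B -> convex_set b) & basis B.
Proof.
exists [set B | exists k e x, B = pball k e x].
  move=> B /[!inE] -[k [e [x ->]]]; apply/convex_setW.
  move=> y z /set_mem yP /set_mem zP l l0 l1; apply/mem_set => j jk.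
  have nl : normc l%:num + normc (1 - l%:num) = 1.
    apply: (@complexI R); rewrite rmorphD /= -!normr_normc.
    by rewrite !ger0_norm ?subr_ge0 ?ltW// subrKC.
  have nl0 : 0 < normc l%:num.
    by rewrite -ltcR -normr_normc normr_gt0 gt_eqF.
  have -> : y <| l |> z - x = l%:num *: (y - x) + (1 - l%:num) *: (z - x).
    rewrite !scalerBr addrACA -opprD -scalerDl subrKC scale1r.
    by [].
  rewrite (le_lt_trans (pnormD _ _ _))// !pnormZ.
  rewrite -[e]mul1r -nl mulrDl ltr_leD// ?ltr_pM2l ?yP//.
  by rewrite ler_wpM2l ?normc_ge0// ltW ?zP.
split; first by move=> B [k [e [x ->]]]; exact: open_pball.
move=> x A [k [e [e0 kA]]]; exists (pball k e x) => //.
by split; [exists k, e, x|exact: pball_center].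
Qed.

HB.instance Definition _ := PreTopologicalLmod_isTvs.Build R[i] L
  add_continuous_proof scale_continuous_proof locally_convex_proof.
(* The factory above only provides the uniform structure. *)
HB.instance Definition _ :=
  PreTopologicalNmodule_isTopologicalNmodule.Build L add_continuous_proof.
HB.instance Definition _ :=
  TopologicalNmodule_isTopologicalLmodule.Build R[i] L scale_continuous_proof.
HB.instance Definition _ := Uniform_isTvs.Build R[i] L locally_convex_proof.

End Lambda0_structure.

Section Cesaro.
Variables (R : realType) (alpha : nat -> R).
Hypothesis alphaP : diverging alpha.
Local Notation L := (Lambda0 alpha).

Definition cesaro_seq (x : nat -> R[i]) : nat -> R[i] :=
  fun n => (\sum_(i < n.+1) x i) / n.+1%:R.

Let weight_noninc k m n : (m <= n)%N -> weight alpha k n <= weight alpha k m.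
Proof.
have [_ inc _] := alphaP.
move=> mn; rewrite /weight ler_expR ler_pM2r ?invr_gt0// lerN2.
by move: m n mn; apply/nondecreasing_seqP => n; exact/ltW/inc.
Qed.

Let normc_sum (x : nat -> R[i]) n :
  normc (\sum_(i < n) x i) <= \sum_(i < n) normc (x i).
Proof.
elim: n => [|n IH]; first by rewrite !big_ord0 [normc _](@normc0 R).
rewrite !big_ord_recr/= (le_trans (le_normcD _ _))// lerD2r.
exact: IH.
Qed.

Let normc_nat n : normc (n%:R : R[i]) = n%:R.
Proof.
by apply: (@complexI R); rewrite -normr_normc normr_nat rmorph_nat.
Qed.

Let weight_cesaro_le k (x : nat -> R[i]) n :
  weight alpha k n * normc (cesaro_seq x n) <=
  arithmetic_mean (fun i => weight alpha k i * normc (x i)) n.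
Proof.
rewrite /arithmetic_mean /series/= /cesaro_seq normcM normcV normc_nat.
rewrite mulrA mulrC ler_wpM2l ?invr_ge0// big_mkord.
rewrite (le_trans (ler_wpM2l (expR_ge0 _) (normc_sum x _)))// mulr_sumr.
apply: ler_sum => i _; rewrite ler_wpM2r ?normc_ge0// weight_noninc//.
by rewrite -ltnS.
Qed.

Lemma cesaro_subproof (x : L) : cesaro_seq x \in Lambda0_pred alpha.
Proof.
apply/asboolP => k.
apply: (squeeze_cvgr _ (cvg_cst 0) (cesaro (@Lambda0_cvg _ _ x k))).
apply: nearW => n; rewrite weight_cesaro_le andbT.
by rewrite mulr_ge0 ?expR_ge0 ?normc_ge0.
Qed.

Definition cesaro_op (x : L) : L := MkLambda0 (cesaro_subproof x).

Lemma cesaro_op_linear : linear cesaro_op.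
Proof.
move=> a x y; apply/Lambda0_eqP => n.
rewrite /= /cesaro_seq.
change ((\sum_(i < n.+1) (a * x i + y i)) / n.+1%:R =
  a * ((\sum_(i < n.+1) x i) / n.+1%:R) + (\sum_(i < n.+1) y i) / n.+1%:R).
by rewrite big_split/= -mulr_sumr mulrDl mulrA.
Qed.

HB.instance Definition _ :=
  GRing.isLinear.Build R[i] L L *:%R cesaro_op cesaro_op_linear.

Lemma pnorm_cesaro k (x : L) : pnorm k (cesaro_op x) <= pnorm k x.
Proof.
apply: pnorm_le => n; apply: (le_trans (weight_cesaro_le _ _ _)).
rewrite /arithmetic_mean /series/= ler_pdivrMl// big_mkord.
apply: (@le_trans _ _ (\sum_(i < n.+1) pnorm k x)).
  by apply: ler_sum => i _; exact: pnorm_ub.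
by rewrite sumr_const card_ord mulr_natl.
Qed.

Lemma cesaro_op_continuous : continuous cesaro_op.
Proof.
move=> x A [k [e [e0 kA]]]; exists k, e; split=> // y yP; apply: kA => j jk.
by rewrite -linearB (le_lt_trans (pnorm_cesaro _ _))// yP.
Qed.

End Cesaro.

Definition Sigma (R : realType) : set R[i] := [set (m.+1%:R)^-1 | m in [set: nat]].

(* Main.v *)
Require Import Defs.
From HB Require Import structures.
From mathcomp Require Import all_boot all_order all_algebra.
From mathcomp Require Import all_classical all_reals all_analysis.
From mathcomp Require Import complex.
From mathcomp Require Import lra ring.

(** All three assertions are equivalent to log n = o(alpha_n), which is used in the
    form [log_negligible]: for every k the sequence (n + 1) w_k(n) is bounded.
    Since w_k is a power of another weight w_k', every polynomial is then absorbed
    by every weight.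

    Nuclearity.  If log n = o(alpha_n), the expansion of the identity along the unit
    vectors is nuclear from p_k' to p_k with k' + 1 = 2 (k + 1): its n-th term
    contributes w_k(n) / w_k'(n) = w_k'(n), which is summable.  Conversely, a
    nuclear factorization x = sum_n f_n(x) y_n with f_n bounded for p_j has a finite
    trace: comparing the m-th entries of both sides at x = e_m / w_j(m), and using
    that the dual norm of p_j is an l^1 norm, bounds sum_m w_k(m) / w_j(m), hence
    sum_m w_k(m), by a multiple of sum_n |f_n| p_k(y_n).  As w_k decreases, (n + 1)
    w_k(n) is at most that sum.

    Spectrum.  With s_n = x_0 + ... + x_(n-1), the equation l x - C x = y reads
    (l - 1/(n+1)) s_(n+1) = y_n + l s_n.  Hence 1/(m+1) is always in the spectrum,
    because e_m is not in the range.  For l outside Sigma the recurrence has exactly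
    one solution, and that solution is larger than y by a polynomial factor at most:
    if log n = o(alpha_n), it defines a continuous inverse and the spectrum is
    Sigma.  In that case the solutions binomial(n, m) of the homogeneous equation
    for l = 1/(m+1) belong to the space, so every point of Sigma is an eigenvalue.

    In the other direction two well chosen numbers are enough to recover
    log n = o(alpha_n).  An eigenvector for 1/2, which must exist if the spectrum
    is the point spectrum, is a multiple of the sequence n.  And if 2/3, which is
    not in Sigma, is in the resolvent set, then the preimage of e_0 grows at least
    like the square root of n.  In both cases a sequence growing like a power of n
    belongs to the space. *)

Set Implicit Arguments.
Unset Strict Implicit.
Unset Printing Implicit Defensive.

Import Order.TTheory GRing.Theory Num.Theory.
Import numFieldNormedType.Exports.
Import Normc.

Local Open Scope classical_set_scope.
Local Open Scope ring_scope.
Local Open Scope complex_scope.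

(** * Moduli of complex numbers *)

Section Modulus.
Variable R : realType.
Implicit Types (x : nat -> R[i]) (a b : R[i]).

Lemma normc_real (r : R) : normc r%:C = `|r|.
Proof. by rewrite /= expr0n addr0 sqrtr_sqr. Qed.

Lemma normc_nat n : normc (n%:R : R[i]) = n%:R.
Proof. by rewrite -(rmorph_nat (real_complex R)) normc_real normr_nat. Qed.

Lemma normc_eq0 a : (normc a == 0) = (a == 0).
Proof. by apply/eqP/eqP => [/eq0_normc|->]; rewrite ?normc0. Qed.

Lemma normc_gt0 a : (0 < normc a) = (a != 0).
Proof. by rewrite lt_def normc_ge0 normc_eq0 andbT. Qed.

Lemma normc_sum (I : Type) (r : seq I) (F : I -> R[i]) :
  normc (\sum_(i <- r) F i) <= \sum_(i <- r) normc (F i).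
Proof.
elim/big_rec2: _ => [|i y z _ le_zy]; first by rewrite normc0.
by rewrite (le_trans (le_normcD _ _))// lerD2l.
Qed.

Lemma normcB_ge a b : normc a - normc b <= normc (a - b).
Proof. by rewrite lerBlDr (le_trans _ (le_normcD _ _))// subrK. Qed.

Lemma normc_phase a : exists2 t : R[i], normc t = 1 & t * a = (normc a)%:C.
Proof.
have [->|a0] := eqVneq a 0; first by exists 1; rewrite ?normc1// mul1r normc0.
exists ((normc a)%:C / a); last by rewrite divfK.
by rewrite normcM normcV normc_real ger0_norm ?normc_ge0// divff ?normc_eq0.
Qed.

End Modulus.

(** * Weights that absorb polynomials *)

Section Weights.
Variables (R : realType) (alpha : nat -> R).
Hypothesis alphaP : diverging alpha.
Local Notation w := (weight alpha).

Lemma weight_gt0 k n : 0 < w k n. Proof. exact: expR_gt0. Qed.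

Lemma weight_ge0 k n : 0 <= w k n. Proof. exact/ltW/weight_gt0. Qed.

Lemma weight_le1 k n : w k n <= 1.
Proof.
have [a1 _ _] := alphaP.
rewrite /weight -expR0 ler_expR mulNr oppr_le0 divr_ge0//.
by rewrite (le_trans ler01)// ltW.
Qed.

Lemma weight_nonincreasing k m n : (m <= n)%N -> w k n <= w k m.
Proof.
have [_ inc _] := alphaP.
move=> mn; rewrite /weight ler_expR ler_pM2r ?invr_gt0// lerN2.
by move: m n mn; apply/nondecreasing_seqP => n; exact/ltW/inc.
Qed.

Lemma weight_mono j k n : (j <= k)%N -> w j n <= w k n.
Proof.
have [a1 _ _] := alphaP.
move=> jk; rewrite /weight ler_expR !mulNr lerN2 ler_pM2l; last first.
  by rewrite (lt_trans ltr01).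
by rewrite lef_pV2 ?posrE// ler_nat.
Qed.

(** The index whose weight is the (p+1)-th root of w_k: weights are numbered from 0,
    so that w_k(n) = exp(- alpha_n / (k+1)). *)
Definition root_index p k := (p.+1 * k.+1).-1.

Lemma weight_root p k n : w k n = w (root_index p k) n ^+ p.+1.
Proof.
rewrite /weight /root_index -expRM_natl; congr expR.
rewrite prednK ?muln_gt0// natrM.
by field; rewrite !nat1r !pnatr_eq0.
Qed.

Lemma pnorm_mono j k (x : Lambda0 alpha) : (j <= k)%N -> pnorm j x <= pnorm k x.
Proof.
move=> jk; apply: pnorm_le => n; apply: le_trans (pnorm_ub k x n).
by rewrite ler_wpM2r ?normc_ge0// weight_mono.
Qed.

Lemma pnorm_eq0 k (x : Lambda0 alpha) : pnorm k x = 0 -> x = 0.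
Proof.
move=> x0; apply/Lambda0_eqP => n; apply: eq0_normc; apply/eqP.
rewrite eq_le normc_ge0 andbT -(pmulr_rle0 _ (weight_gt0 k n)) -x0.
exact: pnorm_ub.
Qed.

(** A form of log n = o(alpha_n) that mentions neither logarithms nor limits: a bound
    on (n+1) w_k(n) says that log (n+1) <= alpha_n / (k+1) + O(1). *)
Definition log_negligible : Prop :=
  forall k, exists M, forall n, n.+1%:R * w k n <= M.

(** The weight is the (q+1)-th power of a weight to which the hypothesis applies. *)
Lemma log_negligible_poly q k : log_negligible ->
  exists M, forall n, n.+1%:R ^+ q.+1 * w k n <= M.
Proof.
move=> /(_ (root_index q k))[M MP]; exists (M ^+ q.+1) => n.
rewrite (weight_root q) -exprMn lerXn2r ?nnegrE//.
  by rewrite mulr_ge0 ?weight_ge0.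
by rewrite (le_trans _ (MP n))// mulr_ge0 ?weight_ge0.
Qed.

(** Splitting w_k = w_k' * w_k' leaves one factor for the given estimate and one to
    swallow the polynomial, together with one more power of n that makes the bound
    tend to 0. *)
Lemma log_negligible_absorb q k : log_negligible -> exists k' M, forall n (a B : R),
  w k' n * a <= B * n.+1%:R ^+ q -> 0 <= B -> w k n * a <= M * B / n.+1%:R.
Proof.
move=> lnP; have [M MP] := log_negligible_poly q (root_index 1 k) lnP.
exists (root_index 1 k), M => n a B aB B0.
rewrite (weight_root 1) expr2 -mulrA ler_pdivlMr// -mulrA.
have wn0 := weight_ge0 (root_index 1 k) n.
apply: (@le_trans _ _ (w (root_index 1 k) n * (B * n.+1%:R ^+ q * n.+1%:R))).
  by rewrite ler_wpM2l// ler_wpM2r.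
rewrite (_ : _ * _ = (n.+1%:R ^+ q.+1 * w (root_index 1 k) n) * B).
  by rewrite ler_wpM2r.
by rewrite exprSr; ring.
Qed.

Lemma log_negligible_Lambda0 q (x : nat -> R[i]) (B : nat -> R) : log_negligible ->
  (forall k, 0 <= B k) ->
  (forall k n, w k n * normc (x n) <= B k * n.+1%:R ^+ q) ->
  x \in Lambda0_pred alpha.
Proof.
move=> lnP B0 xB; apply/asboolP => k.
have [k' [M MP]] := log_negligible_absorb q k lnP.
have lim0 : (M * B k') / n.+1%:R @[n --> \oo] --> (0 : R).
  rewrite -[X in _ --> X](mulr0 (M * B k')).
  by apply: cvgM; [exact: cvg_cst|exact: cvg_harmonic].
apply: (squeeze_cvgr _ (cvg_cst 0) lim0); apply: nearW => n.
by rewrite mulr_ge0 ?weight_ge0 ?normc_ge0// MP.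
Qed.

End Weights.

(** * Solving the resolvent equation *)

Section Resolvent.
Variables (R : realType) (alpha : nat -> R).
Hypothesis alphaP : diverging alpha.
Local Notation w := (weight alpha).
Local Notation L := (Lambda0 alpha).
Local Notation C := (cesaro_op alphaP).

Lemma Lambda0B (x y : L) n : (x - y) n = x n - y n. Proof. by []. Qed.
Lemma Lambda0Z a (x : L) n : (a *: x) n = a * x n. Proof. by []. Qed.

Definition entry n (x : L) : R[i] := x n.

Lemma entry_linear n : linear_for *%R (entry n).
Proof. by move=> a x y. Qed.

HB.instance Definition _ n :=
  GRing.isLinear.Build R[i] L R[i] *%R (entry n) (@entry_linear n).

Lemma delta_subproof m :
  (fun n => (n == m)%:R : R[i]) \in Lambda0_pred alpha.
Proof.
apply/asboolP => k; apply: cvg_near_cst; near=> n.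
have /gtn_eqF -> : (m < n)%N by near: n; exact: nbhs_infty_gt.
by rewrite normc0 mulr0.
Unshelve. all: by end_near. Qed.

Definition delta m : L := MkLambda0 (delta_subproof m).

(** Indexed so that the averages are psum x n.+1 / n.+1, and psum x 0 = 0 starts the
    recurrence. *)
Definition psum (x : nat -> R[i]) n : R[i] := \sum_(i < n) x i.

Lemma psum0 x : psum x 0 = 0. Proof. exact: big_ord0. Qed.

Lemma psumS x n : psum x n.+1 = psum x n + x n.
Proof. exact: big_ord_recr. Qed.

(** In terms of partial sums the resolvent equation is a first order recurrence, from
    which everything about the spectrum is read off. *)
Lemma cesaro_recurrence (l : R[i]) (x : L) n :
  (l - n.+1%:R^-1) * psum x n.+1 = (l *: x - C x) n + l * psum x n.
Proof. rewrite Lambda0B Lambda0Z /= /cesaro_seq -/(psum x n.+1) psumS; ring. Qed.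

Lemma Lambda0_continuous (S : {linear L -> L}) :
  (forall k, exists k' M, forall x, pnorm k (S x) <= M * pnorm k' x) ->
  continuous S.
Proof.
move=> SM x A [k [e [e0 kA]]]; have [k' [M MP]] := SM k.
have M1 : 0 < `|M| + 1 by rewrite ltr_wpDl.
exists k', (e / (`|M| + 1)); split; first by rewrite divr_gt0.
move=> y /(_ k' (leqnn _)) yx; apply: kA => j jk; rewrite -linearB.
rewrite (le_lt_trans (pnorm_mono alphaP _ jk))// (le_lt_trans (MP _))//.
rewrite (@le_lt_trans _ _ ((`|M| + 1) * pnorm k' (y - x)))//.
  by rewrite ler_wpM2r ?pnorm_ge0// (le_trans (ler_norm _))// lerDl.
by rewrite mulrC -ltr_pdivlMr.
Qed.

Section Inverse.
Hypothesis lnP : log_negligible alpha.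
Variable l : R[i].
Hypothesis l_notin : forall n, l - n.+1%:R^-1 != 0.

(** The partial sums of the solution x of l x - C x = y, as dictated by
    [cesaro_recurrence]; l = 0 is allowed. *)
Fixpoint inverse_psum (y : nat -> R[i]) n : R[i] :=
  if n is m.+1 then (y m + l * inverse_psum y m) / (l - m.+1%:R^-1) else 0.

Definition inverse_seq y n := inverse_psum y n.+1 - inverse_psum y n.

Lemma psum_inverse y : psum (inverse_seq y) =1 inverse_psum y.
Proof.
elim=> [|n IH]; first by rewrite psum0.
by rewrite psumS IH subrKC.
Qed.

Lemma inverse_psum_unique (x y : L) :
  l *: x - C x = y -> inverse_psum y =1 psum x.
Proof.
move=> <-; elim=> [|n IH]; first by rewrite psum0.
by rewrite [LHS]/= IH -cesaro_recurrence mulrC mulKf.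
Qed.

(** The two estimates of r_n = 1 / |l - 1/(n+1)| that control the recurrence.  For
    nonzero l the sequence r_n is bounded, and the second estimate follows from
    |l| <= |l - 1/(n+1)| + 1/(n+1); for l = 0 it is trivial and r_n = n + 1. *)
Lemma bounded_reciprocals : exists q, forall n,
  (normc (l - n.+1%:R^-1))^-1 <= q.+1%:R * n.+1%:R /\
  normc l * (normc (l - n.+1%:R^-1))^-1 <= 1 + q.+1%:R / n.+1%:R.
Proof.
have r0 n : 0 < normc (l - n.+1%:R^-1) by rewrite normc_gt0.
have invn n : normc (n.+1%:R^-1 : R[i]) = n.+1%:R^-1 by rewrite normcV normc_nat.
have [l0|l0] := eqVneq l 0.
  exists 0%N => n; rewrite l0 sub0r normcN invn invrK normc0 !mul0r mul1r.
  by rewrite addr_ge0.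
have nl0 : 0 < normc l by rewrite normc_gt0.
suff [q qP] : exists q, forall n, (normc (l - n.+1%:R^-1))^-1 <= q.+1%:R.
  exists q => n; split; first by rewrite (le_trans (qP n))// ler_peMr// ler1n.
  have -> : normc l = normc ((l - n.+1%:R^-1) + n.+1%:R^-1) by rewrite subrK.
  rewrite (le_trans (ler_wpM2r _ (le_normcD _ _))) ?invr_ge0 ?normc_ge0//.
  by rewrite mulrDl divff ?gt_eqF// invn lerD2l mulrC ler_wpM2r ?invr_ge0.
pose K := Num.bound (2 / normc l).
pose B := 2 / normc l + \sum_(i < K) (normc (l - i.+1%:R^-1))^-1.
have S0 : 0 <= \sum_(i < K) (normc (l - i.+1%:R^-1))^-1.
  by apply: sumr_ge0 => i _; rewrite invr_ge0 normc_ge0.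
have l20 : 0 <= 2 / normc l by rewrite divr_ge0// ltW.
exists (Num.bound B) => n.
apply: (@le_trans _ _ B); last first.
  rewrite (@le_trans _ _ (Num.bound B)%:R) ?ler_nat//.
  by rewrite ltW// archi_boundP// addr_ge0.
have [nK|Kn] := ltnP n K.
  rewrite /B (bigD1 (Ordinal nK))//= addrCA lerDl addr_ge0//.
  by apply: sumr_ge0 => i _; rewrite invr_ge0 normc_ge0.
apply: (@le_trans _ _ (2 / normc l)); last by rewrite lerDl.
rewrite -[leRHS]invrK invf_div lef_pV2 ?posrE ?divr_gt0//.
have := normcB_ge l (n.+1%:R^-1); rewrite invn; apply: le_trans.
rewrite lerBrDr -lerBrDl [X in _ <= X - _]splitr addrK.
rewrite -[leRHS]invrK invf_div lef_pV2 ?posrE ?divr_gt0//.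
rewrite ltW// (lt_le_trans (archi_boundP l20))// ler_nat.
exact: leq_trans Kn _.
Qed.

Lemma bernoulli_le (x : R) q : 0 <= x -> 1 + q%:R * x <= (1 + x) ^+ q.
Proof.
move=> x0; elim: q => [|q IH]; first by rewrite mul0r addr0 expr0.
rewrite exprSr; apply: (@le_trans _ _ ((1 + q%:R * x) * (1 + x))).
  rewrite -natr1; have : 0 <= q%:R * x * x by rewrite !mulr_ge0.
  by lra.
by rewrite ler_wpM2r// addr_ge0.
Qed.

(** One step of the recurrence multiplies the sum by at most 1 + q/(n+1), and by the
    Bernoulli inequality the product of these factors is at most (n+1)^q; the factor
    n^2 makes room for the n inhomogeneous terms, of size O(n) each.  The weight is
    taken at any index m from n - 1 on, because the induction compares sums with
    different numbers of terms under one weight. *)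
Lemma inverse_psum_le q k (y : L) :
  (forall n, (normc (l - n.+1%:R^-1))^-1 <= q%:R * n.+1%:R /\
     normc l * (normc (l - n.+1%:R^-1))^-1 <= 1 + q%:R / n.+1%:R) ->
  forall n m, (n <= m.+1)%N -> w k m * normc (inverse_psum y n) <=
    q%:R * pnorm k y * n%:R ^+ 2 * n.+1%:R ^+ q.
Proof.
move=> qP; elim=> [|n IH] m nm.
  by rewrite [inverse_psum _ _]/= normc0 mulr0 expr0n mulr0 mul0r.
rewrite ltnS in nm; have [r1 r2] := qP n; rewrite [inverse_psum _ _]/= normcM normcV.
set r := (normc _)^-1 in r1 r2 *.
have r0 : 0 <= r by rewrite invr_ge0 normc_ge0.
set P := pnorm k y; have P0 : 0 <= P := pnorm_ge0 k y.
have yP : w k m * normc (y n) <= P.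
  apply: le_trans (pnorm_ub k y n).
  by rewrite ler_wpM2r ?normc_ge0// weight_nonincreasing.
have sP := IH m (leqW nm); set T := _ * _ ^+ q in sP.
have T0 : 0 <= T by rewrite !mulr_ge0 ?exprn_ge0.
apply: (@le_trans _ _ (r * P + (normc l * r) * T)).
  rewrite mulrA (mulrC _ r) (mulrC (normc l)) -mulrA -mulrDr ler_wpM2l//.
  rewrite (le_trans (ler_wpM2l (weight_ge0 _ _ _) (le_normcD _ _)))//.
  by rewrite mulrDr lerD// normcM mulrCA ler_wpM2l ?normc_ge0.
apply: (le_trans (lerD (ler_wpM2r P0 r1) (ler_wpM2r T0 r2))).
set N : R := n.+1%:R; have nN : n%:R = N - 1 by rewrite /N -natr1 addrK.
have N1 : 1 <= N by rewrite ler1n.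
have N0 : 0 < N by rewrite ltr0n.
have NS : n.+2%:R = N + 1 by rewrite natr1.
have q0 : 0 <= q%:R :> R by [].
have step : (1 + q%:R / N) * N ^+ q <= (N + 1) ^+ q.
  have := @bernoulli_le N^-1 q; rewrite invr_ge0 => /(_ (ltW N0)) b.
  apply: (le_trans (ler_wpM2r (exprn_ge0 q (ltW N0)) b)).
  by rewrite -exprMn mulrDl mul1r mulVf ?gt_eqF.
have A1 : 1 <= (N + 1) ^+ q by rewrite exprn_ege1// lerDr ltW.
rewrite NS /T nN -/N; move: ((N + 1) ^+ q) A1 step => A A1 step.
apply: (@le_trans _ _ (q%:R * P * (N * A) + q%:R * P * (N - 1) ^+ 2 * A)).
  apply: lerD; first by rewrite mulrAC ler_wpM2l ?mulr_ge0// ler_peMr// ltW.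
  by rewrite mulrCA ler_wpM2l// ?mulr_ge0 ?subr_ge0.
rewrite -[X in _ + X]mulrA -mulrDr -[leRHS]mulrA ler_wpM2l ?mulr_ge0// -mulrDl.
rewrite ler_wpM2r ?(le_trans ler01)//; nra.
Qed.

Lemma inverse_seq_le : exists q (B : R), 0 <= B /\
  forall k (y : L) n,
    w k n * normc (inverse_seq y n) <= B * pnorm k y * n.+1%:R ^+ q.
Proof.
have [q qP] := bounded_reciprocals.
exists (2 + q.+1)%N, (2 * q.+1%:R * 2 ^+ q.+1).
split; first by rewrite !mulr_ge0// exprn_ge0.
move=> k y n; have sP := inverse_psum_le k y qP.
set P := pnorm k y in sP *; have P0 : 0 <= P := pnorm_ge0 k y.
pose D := q.+1%:R * P * n.+1%:R ^+ 2 * n.+2%:R ^+ q.+1.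
apply: (@le_trans _ _ (D + D)).
  rewrite /inverse_seq (le_trans (ler_wpM2l (weight_ge0 _ _ _) (le_normcD _ _)))//.
  rewrite normcN mulrDr; apply: lerD; first exact: sP.
  apply: (le_trans (sP _ _ (leqnSn _))).
  by rewrite ler_pM ?mulr_ge0 ?exprn_ge0// ?ler_wpM2l ?mulr_ge0//
    lerXn2r ?nnegrE// ler_nat.
have -> : 2 * q.+1%:R * 2 ^+ q.+1 * P * n.+1%:R ^+ (2 + q.+1) =
    2 * (q.+1%:R * P * n.+1%:R ^+ 2 * ((2 * n.+1%:R) ^+ q.+1)).
  by rewrite exprMn exprD; ring.
rewrite -[D + D]mulr2n -[D *+ 2]mulr_natl ler_wpM2l// ler_wpM2l ?mulr_ge0//.
rewrite lerXn2r ?nnegrE ?mulr_ge0//.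
by rewrite -natrM ler_nat mul2n -addnn addSn ltnS leq_addl.
Qed.

Lemma inverse_subproof (y : L) : inverse_seq y \in Lambda0_pred alpha.
Proof.
have [q [B [B0 BP]]] := inverse_seq_le.
apply: (log_negligible_Lambda0 (q := q) (B := fun k => B * pnorm k y)) => // k.
by rewrite mulr_ge0 ?pnorm_ge0.
Qed.

Definition inverse_op (y : L) : L := MkLambda0 (inverse_subproof y).

Lemma inverse_opK : cancel inverse_op (fun x => l *: x - C x).
Proof.
move=> y; apply/Lambda0_eqP => n.
have := cesaro_recurrence l (inverse_op y) n.
rewrite !psum_inverse [inverse_psum _ _.+1]/= mulrC divfK//.
by move/addIr.
Qed.

Lemma resolventK : cancel (fun x => l *: x - C x) inverse_op.
Proof.
move=> x; apply/Lambda0_eqP => n.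
by rewrite /= /inverse_seq !(inverse_psum_unique (erefl _)) psumS addrAC subrr add0r.
Qed.

(** The inverse of a linear bijection is linear. *)
Lemma inverse_op_linear : linear inverse_op.
Proof.
move=> a x y; apply: (can_inj resolventK); rewrite inverse_opK.
rewrite [C _]linearP scalerDr scalerA mulrC -scalerA opprD addrACA -scalerBr.
by rewrite !inverse_opK.
Qed.

HB.instance Definition _ :=
  GRing.isLinear.Build R[i] L L *:%R inverse_op inverse_op_linear.

Lemma inverse_op_continuous : continuous inverse_op.
Proof.
apply: Lambda0_continuous => k; have [q [B [B0 BP]]] := inverse_seq_le.
have [k' [M MP]] := log_negligible_absorb q k lnP.
exists k', (`|M| * B) => y; apply: pnorm_le => n.
have BP0 : 0 <= B * pnorm k' y by rewrite mulr_ge0 ?pnorm_ge0.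
apply: (le_trans (MP n _ _ (BP k' y n) BP0)).
rewrite ler_pdivrMr// (@le_trans _ _ (`|M| * (B * pnorm k' y)))//.
  by rewrite ler_wpM2r// ler_norm.
by rewrite mulrA ler_peMr ?ler1n// !mulr_ge0 ?pnorm_ge0.
Qed.

End Inverse.
End Resolvent.

(** * The spectrum of the operator *)

Section SpectrumOfCesaro.
Variables (R : realType) (alpha : nat -> R).
Hypothesis alphaP : diverging alpha.
Local Notation w := (weight alpha).
Local Notation L := (Lambda0 alpha).
Local Notation C := (cesaro_op alphaP).

Lemma Sigma_subP (l : R[i]) : ~ @Sigma R l -> forall n, l - n.+1%:R^-1 != 0.
Proof. by move=> lS n; apply/eqP => /subr0_eq le; apply: lS; exists n. Qed.

Lemma log_negligible_spectrum_sub : log_negligible alpha -> spectrum C `<=` @Sigma R.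
Proof.
move=> lnP l; apply: contra_notP => /Sigma_subP l_notin.
exists (inverse_op alphaP lnP l_notin).
by split; [exact: inverse_op_continuous|exact: resolventK|exact: inverse_opK].
Qed.

(** A preimage x of e_m under 1/(m+1) - C would have vanishing partial sums up to m,
    and then the recurrence at m, whose leading coefficient is 0, reads 0 = 1. *)
Lemma Sigma_sub_spectrum : @Sigma R `<=` spectrum C.
Proof.
move=> _ [m _ <-] [S [_ _ SK]].
have rec := cesaro_recurrence alphaP (m.+1%:R^-1) (S (delta alpha m)).
set x := S _ in rec; have xE : m.+1%:R^-1 *: x - C x = delta alpha m by exact: SK.
rewrite xE in rec.
have s0 n : (n <= m)%N -> psum x n = 0.
  elim: n => [|n IH] nm; first exact: psum0.
  apply/eqP; have := rec n; rewrite (IH (ltnW nm)) mulr0 addr0 /= (ltn_eqF nm).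
  move/eqP; rewrite mulf_eq0 subr_eq0 => /orP[|//].
  by rewrite (inj_eq invr_inj) eqr_nat eqSS eq_sym (ltn_eqF nm).
have /eqP := rec m; rewrite subrr mul0r s0// mulr0 addr0 /= eqxx.
by rewrite eq_sym oner_eq0.
Qed.

Lemma point_spectrum_sub : point_spectrum C `<=` spectrum C.
Proof. by move=> l ninj [S [_ SK _]]; apply: ninj; exact: can_inj SK. Qed.

Lemma bin_le_expn n m : ('C(n, m) <= n.+1 ^ m)%N.
Proof.
elim: n m => [|n IH] [|m]; rewrite ?bin0 ?expn0//.
rewrite binS (leq_trans (leq_add (IH _) (IH _)))//.
by rewrite expnS addnC -mulSn expnS leq_mul//; case: m => // m; rewrite leq_exp2r.
Qed.

Lemma sum_bin_diag m n : (\sum_(i < n) 'C(i, m) = 'C(n, m.+1))%N.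
Proof.
elim: n => [|n IH]; first by rewrite big_ord0.
by rewrite big_ord_recr/= IH binS.
Qed.

(** The eigenvector for 1/(m+1) is the column binomial(n, m) of Pascal's triangle, by
    the hockey stick identity; it grows like n^m. *)
Lemma log_negligible_Sigma_sub : log_negligible alpha -> @Sigma R `<=` point_spectrum C.
Proof.
move=> lnP _ [m _ <-] inj.
have xP : (fun n => 'C(n, m)%:R : R[i]) \in Lambda0_pred alpha.
  apply: (log_negligible_Lambda0 (q := m) (B := fun=> 1)) => // k n.
  rewrite normc_nat mul1r -[leRHS]mul1r ler_pM ?weight_ge0 ?weight_le1//.
  rewrite -natrX ler_nat.
  exact: bin_le_expn.
have x0 : MkLambda0 xP = 0.
  apply: inj; rewrite [C 0]linear0 scaler0 subr0; apply/Lambda0_eqP => n.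
  rewrite Lambda0B Lambda0Z /= /cesaro_seq /= -natr_sum sum_bin_diag.
  have -> : 'C(n.+1, m.+1)%:R / n.+1%:R = m.+1%:R^-1 * 'C(n, m)%:R :> R[i].
    rewrite [RHS]mulrC; apply/eqP.
    rewrite eqr_div ?pnatr_eq0// -!natrM eqr_nat [eqbRHS]mulnC.
    by rewrite (mul_bin_diag n.+1) mulnC.
  by rewrite subrr.
have /eqP : 'C(m, m)%:R = 0 :> R[i] := congr1 (fun z : L => z m) x0.
by rewrite binn oner_eq0.
Qed.

(** The recurrence for l = 1/2 forces an eigenvector to be a multiple of the sequence
    n. *)
Lemma half_point_log_negligible : point_spectrum C (2%:R^-1) -> log_negligible alpha.
Proof.
move=> ninj.
have [z z0 zC] : exists2 z : L, z != 0 & 2%:R^-1 *: z - C z = 0.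
  apply: contra_notP ninj => nz x y xy; apply: subr0_eq; apply/eqP.
  apply/negPn/negP => xy0; apply: nz; exists (x - y) => //.
  by rewrite [C _]linearB scalerBr opprD addrACA -opprD [X in X - _]xy subrr.
have rec n := cesaro_recurrence alphaP (2%:R^-1) z n.
have sE n : 2%:R * psum z n.+1 = (n * n.+1)%:R * z 1%N.
  elim: n => [|[|n] IH].
  - have := rec 0%N; rewrite zC psum0 mulr0 addr0 => /eqP.
    rewrite mulf_eq0 subr_eq0 (inj_eq invr_inj) eqr_nat /= => /eqP ->.
    by rewrite mul0n mul0r mulr0.
  - by rewrite psumS mulrDr IH !mul0n mul0r add0r.
  have := rec n.+2; rewrite zC add0r.
  move=> /(congr1 (fun u => (2%:R * n.+3%:R) * (2%:R * u))).
  have -> : 2%:R * n.+3%:R * (2%:R * ((2%:R^-1 - n.+3%:R^-1) * psum z n.+3)) =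
     n.+1%:R * (2%:R * psum z n.+3) :> R[i].
    by field; rewrite -natrD pnatr_eq0.
  have -> : 2%:R * n.+3%:R * (2%:R * (2%:R^-1 * psum z n.+2)) =
     n.+3%:R * (2%:R * psum z n.+2) :> R[i].
    by field.
  rewrite IH => e; apply: (@mulfI _ n.+1%:R); first by rewrite pnatr_eq0.
  by rewrite e !natrM; ring.
have zE n : z n = n%:R * z 1%N.
  apply: (@mulfI _ 2%:R); first by rewrite pnatr_eq0.
  case: n => [|n].
    have := sE 0%N; rewrite psumS psum0 add0r => ->.
    by rewrite mul0n !mul0r mulr0.
  have := sE n.+1; rewrite psumS mulrDr sE => /(canRL (addKr _)) ->.
  by rewrite !natrM -[n.+2]addn1 -[n.+1]addn1 !natrD; ring.
have z1 : z 1%N != 0.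
  apply: contra_neq z0 => z1; apply/Lambda0_eqP => n.
  by rewrite zE z1 mulr0.
move=> k; exists (pnorm k z / normc (z 1%N) + 1) => n.
rewrite -natr1 mulrDl mul1r lerD ?weight_le1//.
rewrite ler_pdivlMr ?normc_gt0// (le_trans _ (pnorm_ub k z n))//.
by rewrite [z n]zE normcM normc_nat mulrA [n%:R * _]mulrC.
Qed.

Lemma two_thirds_notin : ~ @Sigma R (2%:R / 3%:R).
Proof.
move=> [m _ /(congr1 (fun u => u * (3%:R * m.+1%:R)))].
have -> : m.+1%:R^-1 * (3%:R * m.+1%:R) = 3%:R :> R[i].
  by rewrite mulrCA mulVf ?mulr1// pnatr_eq0.
rewrite mulrA divfK ?pnatr_eq0// -natrM => /eqP; rewrite eqr_nat => /eqP.
by move=> /(congr1 odd); rewrite oddM.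
Qed.

(** The preimage x of e_0 under 2/3 - C satisfies |x_n|^2 >= n + 1: in general the
    preimage under l - C grows like n^(Re(1/l) - 1), and 1/l = 3/2 here. *)
Lemma two_thirds_log_negligible : ~ spectrum C (2%:R / 3%:R) -> log_negligible alpha.
Proof.
move=> /contrapT[S [_ _ SK]].
have rec := cesaro_recurrence alphaP (2%:R / 3%:R) (S (delta alpha 0)).
set x := S _ in rec.
have xE : (2%:R / 3%:R) *: x - C x = delta alpha 0%N by exact: SK.
rewrite xE in rec.
have s1 : psum x 1 = - 3%:R.
  have := rec 0%N; rewrite psum0 mulr0 addr0.
  move=> /(congr1 (fun u => - 3%:R * u)); rewrite [in RHS]mulr1 => <-.
  by field.
have step n : (2 * n).+1%:R * normc (psum x n.+2) =
    2 * n.+2%:R * normc (psum x n.+1).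
  have := rec n.+1; rewrite add0r => /(congr1 (fun u => 3%:R * n.+2%:R * u)).
  have -> : 3%:R * n.+2%:R * ((2%:R / 3%:R - n.+2%:R^-1) * psum x n.+2) =
      (2 * n).+1%:R * psum x n.+2 :> R[i].
    rewrite -[(2 * n).+1]addn1 natrD natrM; by field; rewrite -natrD pnatr_eq0.
  have -> : 3%:R * n.+2%:R * (2%:R / 3%:R * psum x n.+1) =
      (2 * n.+2)%:R * psum x n.+1 :> R[i].
    by rewrite natrM; field.
  by move=> /(congr1 (@normc R)); rewrite !normcM !normc_nat natrM.
have sP n : n.+1%:R ^+ 3 <= normc (psum x n.+1) ^+ 2.
  elim: n => [|n IH].
    by rewrite s1 normcN normc_nat expr1n -natrX ler1n.
  have d0 : 0 < (2 * n).+1%:R ^+ 2 :> R by rewrite exprn_gt0.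
  rewrite -(ler_pM2l d0) -[leRHS]exprMn step exprMn.
  (* The step multiplies the left side by (N+1)^3 / N^3 and the right side by
     (2(N+1))^2 / (2N-1)^2, where N = n+1. *)
  apply: (@le_trans _ _ ((2 * n.+2%:R) ^+ 2 * n.+1%:R ^+ 3)); last first.
    by rewrite ler_wpM2l// exprn_ge0// mulr_ge0.
  set N : R := n.+1%:R; have N1 : 1 <= N by rewrite ler1n.
  have -> : (2 * n).+1%:R = 2 * N - 1.
    by rewrite -natr1 natrM /N -natr1; ring.
  rewrite -[n.+2%:R]natr1 -/N -subr_ge0.
  have -> : (2 * (N + 1)) ^+ 2 * N ^+ 3 - (2 * N - 1) ^+ 2 * (N + 1) ^+ 3 =
      (N + 1) ^+ 2 * (3 * N - 1) by ring.
  by rewrite mulr_ge0 ?sqr_ge0//; lra.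
have xP n : n.+1%:R <= normc (x n) ^+ 2.
  case: n => [|n].
    have := psumS x 0; rewrite s1 psum0 add0r => <-.
    by rewrite normcN normc_nat -natrX ler1n.
  have xE1 : 2%:R / 3%:R * x n.+1 - psum x n.+2 / n.+2%:R = 0.
    have := congr1 (fun u : L => u n.+1) xE.
    by rewrite Lambda0B Lambda0Z.
  have e : 2%:R * normc (x n.+1) = 3%:R * (normc (psum x n.+2) / n.+2%:R).
    rewrite -!normc_nat -normcV -!normcM; congr (normc _).
    by move/subr0_eq : xE1 => <-; field.
  have /(ler_wpM2l (exprn_ge0 2 (ler0n R 3))) := sP n.+1.
  have -> : normc (psum x n.+2) = 2%:R * normc (x n.+1) * n.+2%:R / 3%:R.
    by rewrite e; field; rewrite -natrD pnatr_eq0.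
  set N : R := n.+2%:R; have N0 : 0 < N by rewrite ltr0n.
  set X := normc _ => le9.
  have : 9 * N <= 4 * X ^+ 2.
    rewrite -(ler_pM2r (exprn_gt0 2 N0)).
    by apply: le_trans (le_trans _ le9) _; rewrite le_eqVlt; apply/orP; left;
      apply/eqP; field.
  by lra.
move=> k; exists (pnorm (root_index 1 k) x ^+ 2) => n.
rewrite (weight_root alpha 1) (le_trans (ler_wpM2r _ (xP n)))//.
  by rewrite exprn_ge0// weight_ge0.
rewrite mulrC -exprMn lerXn2r ?nnegrE ?pnorm_ge0 ?pnorm_ub//.
by rewrite mulr_ge0 ?weight_ge0 ?normc_ge0.
Qed.

End SpectrumOfCesaro.

(** * Continuous seminorms and the unit vector basis *)

Section Seminorms.
Variables (R : realType) (alpha : nat -> R).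
Hypothesis alphaP : diverging alpha.
Local Notation w := (weight alpha).
Local Notation L := (Lambda0 alpha).

Lemma seminorm_dominated (p : L -> R) : is_seminorm p -> continuous p ->
  exists k c, 0 < c /\ forall x, p x <= c * pnorm k x.
Proof.
move=> [p0 pZ _] pc.
have p00 : p 0 = 0 by rewrite -(scale0r 0) pZ normc0 mul0r.
have [k [e [e0 kA]]] : nbhs (0 : L) (p @^-1` [set r | r < 1]).
  by apply: pc; rewrite p00; exact: lt_nbhsl.
exists k, (2 / e); split=> [|x]; first by rewrite divr_gt0.
have [->|x0] := eqVneq x 0; first by rewrite p00 pnorm0 mulr0.
have nx0 : 0 < pnorm k x.
  by rewrite lt_def pnorm_ge0 andbT; apply: contra_neq x0; exact: pnorm_eq0.
pose t := e / 2 / pnorm k x.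
have t0 : 0 < t by rewrite !divr_gt0.
have : p (t%:C *: x) < 1.
  apply: kA => j jk; rewrite subr0 pnormZ normc_real gtr0_norm//.
  rewrite (@le_lt_trans _ _ (t * pnorm k x))//.
    by rewrite ler_pM2l// pnorm_mono.
  by rewrite /t divfK ?gt_eqF// ltr_pdivrMr// ltr_pMr// ltr1n.
rewrite pZ normc_real gtr0_norm// -ltr_pdivlMl// mulr1 => /ltW.
by rewrite /t !invf_div mulrC.
Qed.

Lemma scaled_pnorm_seminorm k (c : R) : 0 <= c ->
  is_seminorm (fun x : L => c * pnorm k x).
Proof.
move=> c0; split=> [x|a x|x y]; first by rewrite mulr_ge0 ?pnorm_ge0.
  by rewrite pnormZ mulrCA.
by rewrite -mulrDr ler_wpM2l// pnormD.
Qed.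

Lemma pnorm_dist k (x y : L) : `|pnorm k x - pnorm k y| <= pnorm k (x - y).
Proof.
have tri (u v : L) : pnorm k u - pnorm k v <= pnorm k (u - v).
  by rewrite lerBlDr (le_trans _ (pnormD _ _ _))// subrK.
by rewrite ler_norml tri andbT lerNl opprB pnormB tri.
Qed.

Lemma pnorm_continuous k : continuous (@pnorm R alpha k).
Proof.
move=> x A /nbhs_ballP[e e0 eA]; exists k, e; split=> // y /(_ k (leqnn k)) xy.
apply: eA; rewrite /ball/= distrC; apply: le_lt_trans xy.
exact: pnorm_dist.
Qed.

Lemma scaled_pnorm_continuous k (c : R) :
  continuous (fun x : L => c * pnorm k x).
Proof.
move=> x; apply: (@continuous_comp _ _ _ (@pnorm R alpha k) ( *%R c)).
  exact: pnorm_continuous.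
exact: mulrl_continuous.
Qed.

Lemma delta_combE (a : nat -> R[i]) N n :
  (\sum_(0 <= m < N) a m *: delta alpha m) n = if (n < N)%N then a n else 0.
Proof.
rewrite -/(entry n _) linear_sum /entry.
have -> : \sum_(0 <= m < N) (a m *: delta alpha m) n =
    \sum_(0 <= m < N | m == n) a m.
  rewrite [RHS]big_mkcond; apply: eq_bigr => i _.
  by rewrite Lambda0Z /= eq_sym; case: eqP => [->|_]; rewrite ?mulr1 ?mulr0.
by rewrite (big_nat1_eq _ a).
Qed.

(** The remainder is the tail of x, whose norm tends to 0 because w_k(n) |x_n| does. *)
Lemma delta_expansion_cvg k (x : L) :
  pnorm k (x - \sum_(0 <= n < N) x n *: delta alpha n) @[N --> \oo]
    --> (0 : R).
Proof.
apply/cvgrPdist_le => e e0.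
have /cvgrPdist_le/(_ e e0)[N0 _ N0P] := @Lambda0_cvg _ _ x k.
exists N0 => // N /= NN; rewrite sub0r normrN ger0_norm ?pnorm_ge0//.
apply: pnorm_le => n; rewrite Lambda0B delta_combE.
case: ltnP => [_|Nn]; first by rewrite subrr normc0 mulr0 ltW.
have := N0P n (leq_trans NN Nn).
by rewrite /= sub0r normrN subr0 ger0_norm// mulr_ge0 ?weight_ge0 ?normc_ge0.
Qed.

End Seminorms.

(** * Nuclearity *)

Section Nuclearity.
Variables (R : realType) (alpha : nat -> R).
Hypothesis alphaP : diverging alpha.
Local Notation w := (weight alpha).
Local Notation L := (Lambda0 alpha).

Lemma dual_norm_ge0 (q : L -> R) (f : {scalar L}) :
  is_seminorm q -> (0 <= dual_norm q f)%E.
Proof.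
move=> [_ qZ _]; apply: ereal_sup_ubound; exists 0; last by rewrite linear0 normc0.
by rewrite /= -(scale0r 0) qZ normc0 mul0r.
Qed.

Lemma pnorm_delta k n : pnorm k (delta alpha n) <= w k n.
Proof.
apply: pnorm_le => i /=; case: eqP => [->|_]; first by rewrite normc1 mulr1.
by rewrite normc0 mulr0 weight_ge0.
Qed.

Lemma dual_norm_entry k (c : R) n : 0 < c ->
  (dual_norm (fun x : L => (c * pnorm k x)%R) (entry n) <= (c * w k n)^-1%:E)%E.
Proof.
move=> c0; apply: ge_ereal_sup => _ [x /= xq <-]; rewrite lee_fin.
rewrite -[leRHS]mul1r ler_pdivlMr ?mulr_gt0 ?weight_gt0//.
by rewrite mulrC -mulrA (le_trans _ xq)// ler_pM2l// pnorm_ub.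
Qed.

(** Comparison of w_k(n) with 1/(n+1)^2. *)
Lemma log_negligible_sum_le k : log_negligible alpha ->
  exists M, forall N, \sum_(0 <= n < N) w k n <= M.
Proof.
move=> /(log_negligible_poly 1 k)[M MP].
have M0 : 0 <= M by rewrite (le_trans _ (MP 0%N))// mulr_ge0 ?weight_ge0.
exists (2 * M) => N.
(* The telescoping form that makes the induction work: M / n^2 is at most
   2M/n - 2M/(n+1) for n >= 1. *)
apply: (@le_trans _ _ (2 * M - 2 * M / N.+1%:R)); last first.
  by rewrite gerBl !mulr_ge0.
elim: N => [|N IH]; first by rewrite big_geq// divr1 subrr.
rewrite big_nat_recr//=; apply: (le_trans (lerD IH (lexx _))).
have n1 : (1 : R) <= N.+1%:R by rewrite ler1n.
have := MP N; rewrite -[in N.+2%:R](natr1 N.+1).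
move: N.+1%:R (ltr0Sn R N) n1 => n n0 n1 wM.
have wle : w k N <= M / n ^+ 2 by rewrite ler_pdivlMr ?exprn_gt0// mulrC.
apply: (le_trans (lerD (lexx _) wle)).
rewrite -subr_ge0.
have -> : 2 * M - 2 * M / (n + 1) - (2 * M - 2 * M / n + M / n ^+ 2) =
   M * (n - 1) / (n ^+ 2 * (n + 1)).
  by field; rewrite !gt_eqF//; lra.
by rewrite divr_ge0 ?mulr_ge0 ?exprn_ge0//; lra.
Qed.

Lemma log_negligible_nuclear : log_negligible alpha -> nuclear_space L.
Proof.
move=> lnP p p_semi p_cont.
have [k [c [c0 pk]]] := seminorm_dominated alphaP p_semi p_cont.
pose k' := root_index 1 k.
have q_semi := scaled_pnorm_seminorm alpha k' (ltW c0).
exists (fun x => c * pnorm k' x); split=> //.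
- exact: scaled_pnorm_continuous.
- move=> x; rewrite (le_trans (pk x))// ler_pM2l// pnorm_mono//.
  by rewrite /k' /root_index mul2n -addnn -ltnS prednK// leq_addl.
exists (fun n => entry n : {scalar L}), (delta alpha).
have p0 x : 0 <= p x by have [] := p_semi.
have term0 n : (0 <= dual_norm (fun x : L => (c * pnorm k' x)%R) (entry n)
      * (p (delta alpha n))%:E)%E.
  by rewrite mule_ge0 ?lee_fin// dual_norm_ge0.
split.
- by move=> n; apply: le_lt_trans (dual_norm_entry _ _ c0) (ltry _).
- have [M MP] := log_negligible_sum_le k' lnP.
  apply: (@le_lt_trans _ _ M%:E); last exact: ltry.
  apply: lime_le; first by apply: is_cvg_nneseries => n _ _; exact: term0.
  apply: nearW => N; apply: (@le_trans _ _ (\sum_(0 <= n < N) w k' n)%:E); last first.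
    by rewrite lee_fin.
  rewrite -sumEFin; apply: lee_sum => n _.
  apply: (@le_trans _ _ ((c * w k' n)^-1%:E * (c * w k n)%:E)%E).
    rewrite lee_pmul ?dual_norm_ge0 ?lee_fin//; first exact: dual_norm_entry.
    by rewrite (le_trans (pk _))// ler_pM2l// pnorm_delta.
  rewrite -EFinM lee_fin (weight_root alpha 1 k) -/k' le_eqVlt; apply/orP; left.
  by apply/eqP; field; rewrite !gt_eqF ?weight_gt0.
- move=> x; apply: (squeeze_cvgr (f := cst 0) (h := fun N =>
    c * pnorm k (x - \sum_(0 <= n < N) x n *: delta alpha n))).
  + by apply: nearW => N; rewrite p0 pk.
  + exact: cvg_cst.
  + rewrite -[X in _ --> X](mulr0 c); apply: cvgMr.
    exact: delta_expansion_cvg.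
Qed.

(** The dual of a weighted c_0 norm is a weighted l^1 norm: the functional is tested
    on a finite combination of unit vectors whose phases make all terms of the value
    nonnegative, and whose moduli 1 / w_j make all weighted entries equal. *)
Lemma functional_l1_bound (q : L -> R) (f : {scalar L}) j (c D : R) M :
  0 < c -> (forall x, q x <= c * pnorm j x) ->
  (forall x, q x <= 1 -> normc (f x) <= D) ->
  \sum_(0 <= m < M) normc (f (delta alpha m)) / w j m <= c * D.
Proof.
move=> c0 qc fD.
have /choice[t tP] : forall m, exists t : R[i], normc t = 1 /\
    t * f (delta alpha m) = (normc (f (delta alpha m)))%:C.
  by move=> m; have [t t1 tf] := normc_phase (f (delta alpha m)); exists t.
pose a m : R[i] := (c * w j m)^-1%:C * t m.
pose v := \sum_(0 <= m < M) a m *: delta alpha m.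
have /fD : q v <= 1.
  rewrite (le_trans (qc v))// mulrC -ler_pdivlMr// mul1r.
  apply: pnorm_le => i; rewrite delta_combE; case: ifP => _; last first.
    by rewrite normc0 mulr0 invr_ge0 ltW.
  have [ti1 _] := tP i.
  rewrite normcM ti1 mulr1 normc_real ger0_norm; last first.
    by rewrite invr_ge0 mulr_ge0 ?weight_ge0// ltW.
  by rewrite invfM mulrCA divff ?mulr1// gt_eqF ?weight_gt0.
have -> : f v = (c^-1 * \sum_(0 <= m < M) normc (f (delta alpha m)) / w j m)%:C.
  rewrite linear_sum mulr_sumr rmorph_sum; apply: eq_bigr => m _.
  have [_ tmP] := tP m.
  by rewrite linearZ/= -mulrA tmP -rmorphM/= invfM -mulrA (mulrC (w j m)^-1).
rewrite normc_real => /(le_trans (ler_norm _)).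
by rewrite mulrC ler_pdivrMr// mulrC.
Qed.

(** The trace argument.  The m-th entry of e_m = sum_n f_n(e_m) y_n gives
    w_k(m) <= sum_n |f_n(e_m)| p_k(y_n).  Dividing by w_j(m), which is at most 1,
    summing over m, and using the l^1 bound for each f_n leaves a sum over n that
    nuclearity makes finite. *)
Lemma nuclear_weight_sum k : nuclear_space L ->
  exists S, forall M, \sum_(0 <= m < M) w k m <= S.
Proof.
move=> /(_ _ (pnorm_seminorm alpha k) (@pnorm_continuous _ _ k)).
move=> [q [q_semi q_cont _ [f [y [f_fin sum_fin lim0]]]]].
have [j [c [c0 qc]]] := seminorm_dominated alphaP q_semi q_cont.
have dn_ge0 n : (0 <= dual_norm q (f n))%E := dual_norm_ge0 (f n) q_semi.
pose D n := fine (dual_norm q (f n)).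
have DE n : dual_norm q (f n) = (D n)%:E.
  by rewrite fineK// ge0_fin_numE// f_fin.
have fD n x : q x <= 1 -> normc (f n x) <= D n.
  by move=> qx; rewrite -lee_fin -DE; apply: ereal_sup_ubound; exists x.
have term_ge0 n : (0 <= dual_norm q (f n) * (pnorm k (y n))%:E)%E.
  by rewrite mule_ge0 ?lee_fin ?pnorm_ge0.
set s := (\sum_(0 <= n <oo) _)%E in sum_fin.
have s_ge0 : (0 <= s)%E by apply: nneseries_ge0.
pose S := fine s.
have SP N : \sum_(0 <= n < N) D n * pnorm k (y n) <= S.
  rewrite -lee_fin /S fineK ?ge0_fin_numE// -sumEFin.
  under eq_bigr do rewrite EFinM -DE.
  exact: nneseries_lim_ge.
exists (c * S) => M.
(* The error of the truncated expansion; for fixed M it disappears in the limit. *)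
pose E N m := pnorm k
  (delta alpha m - \sum_(0 <= n < N) f n (delta alpha m) *: y n).
have bound N : \sum_(0 <= m < M) w k m <=
    c * S + \sum_(0 <= m < M) E N m / w j m.
  have le_m m : w k m <= E N m / w j m +
     \sum_(0 <= n < N) pnorm k (y n) * (normc (f n (delta alpha m)) / w j m).
    have w0 := weight_gt0 alpha j m.
    have -> : E N m / w j m +
        \sum_(0 <= n < N) pnorm k (y n) * (normc (f n (delta alpha m)) / w j m) =
        (E N m + \sum_(0 <= n < N) pnorm k (y n) * normc (f n (delta alpha m)))
          / w j m.
      by rewrite mulrDl mulr_suml; under [in RHS]eq_bigr do rewrite -mulrA.
    rewrite ler_pdivlMr// (le_trans (ler_piMr (weight_ge0 _ _ _) _))//.
      exact: weight_le1.
    set Y := \sum_(0 <= n < N) f n (delta alpha m) *: y n.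
    have e1 : normc ((delta alpha m - Y) m + Y m) = 1.
      by rewrite Lambda0B subrK /= eqxx normc1.
    rewrite -[leLHS]mulr1 -e1.
    rewrite (le_trans (ler_wpM2l (weight_ge0 _ _ _) (le_normcD _ _)))//.
    rewrite mulrDr lerD ?pnorm_ub//.
    rewrite -/(entry m Y) /Y linear_sum /entry.
    rewrite (le_trans (ler_wpM2l (weight_ge0 _ _ _) (normc_sum _ _)))// mulr_sumr.
    apply: ler_sum => n _; rewrite linearZ normcM mulrCA mulrC.
    by rewrite ler_wpM2r ?normc_ge0// pnorm_ub.
  apply: (le_trans (ler_sum _ (fun m _ => le_m m))).
  rewrite big_split/= addrC lerD2r exchange_big/=.
  apply: (@le_trans _ _ (\sum_(0 <= n < N) c * (D n * pnorm k (y n)))).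
    apply: ler_sum => n _; rewrite -mulr_sumr mulrA [leRHS]mulrC.
    rewrite ler_wpM2l ?pnorm_ge0//.
    exact: functional_l1_bound c0 qc (fD n).
  by rewrite -mulr_sumr ler_pM2l.
have lim : c * S + \sum_(0 <= m < M) E N m / w j m @[N --> \oo] --> c * S.
  rewrite -[X in _ --> X]addr0; apply: cvgD; first exact: cvg_cst.
  elim: M {bound} => [|M IH].
    by under eq_fun do rewrite big_geq//; exact: cvg_cst.
  rewrite [X in X @ _](_ : _ =
      fun N => \sum_(0 <= m < M) E N m / w j m + E N M / w j M); last first.
    by apply/funext => N; rewrite big_nat_recr.
  rewrite -[X in _ --> X]addr0; apply: cvgD => //.
  by rewrite -[X in _ --> X](mul0r (w j M)^-1); apply: cvgMl; exact: lim0.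
apply: (ler_cvg_to (cvg_cst _) lim); exact: nearW bound.
Qed.

Lemma nuclear_log_negligible : nuclear_space L -> log_negligible alpha.
Proof.
move=> nuc k; have [S SP] := nuclear_weight_sum k nuc.
exists S => n; apply: le_trans (SP n.+1).
rewrite mulr_natl -[X in w k n *+ X]subn0 -sumr_const_nat big_nat [leRHS]big_nat.
by apply: ler_sum => m mn; rewrite weight_nonincreasing.
Qed.

End Nuclearity.

(** * The equivalence *)

Theorem corollary2p13 (R : realType) (alpha : nat -> R)
    (alphaP : diverging alpha) :
  [<-> nuclear_space (Lambda0 alpha);
       spectrum (cesaro_op alphaP) = point_spectrum (cesaro_op alphaP);
       spectrum (cesaro_op alphaP) = @Sigma R].
Proof.
have spectrumE : log_negligible alpha -> spectrum (cesaro_op alphaP) = @Sigma R.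
  move=> lnP; apply/seteqP; split; first exact: log_negligible_spectrum_sub.
  exact: Sigma_sub_spectrum.
tfae.
- move=> /(nuclear_log_negligible alphaP) lnP; apply/seteqP; split; last first.
    exact: point_spectrum_sub.
  by rewrite spectrumE//; exact: log_negligible_Sigma_sub.
- move=> spE; apply: spectrumE; apply: (half_point_log_negligible (alphaP := alphaP)).
  by rewrite -spE; apply: Sigma_sub_spectrum; exists 1%N.
- move=> spE; apply: (log_negligible_nuclear alphaP).
  apply: (two_thirds_log_negligible (alphaP := alphaP)); rewrite spE.
  exact: two_thirds_notin.
Qed.
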